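(* Let $N\ge 2$, $R>0$ and $Q_{2R}=(-R,R)^N$. The principal eigenvalue of $\mathcal{P}^+_1$ in the cube $Q_{2R}$ is $$\mu_1^+=\frac{1}{N}\left(\frac{\pi}{2R}\right)^2$$ and a corresponding principal eigenfunction is given by $$u(x)=\prod_{i=1}^N\sqrt[N]{\cos\left(\frac{\pi}{2R}x_i\right)}.$$
   Context: For a symmetric real $N\times N$ matrix $X$, $\mathcal{P}^+_1(X)=\lambda_N(X)$ denotes its largest eigenvalue. For a bounded domain $\Omega\subset\mathbb{R}^N$, the principal eigenvalue of $\mathcal{P}^+_1$ in $\Omega$ is $$\mu_1^+=\mu_1^+(\Omega)=\sup\{\mu\in\mathbb{R} : \exists\, \phi>0 \text{ in } \Omega,\ \mathcal{P}^+_1(D^2\phi)+\mu\phi\le 0 \text{ in }\Omega\},$$ where $\phi$ is lower semicontinuous and the inequality is understood in the viscosity sense. A principal eigenfunction of $\mathcal{P}^+_1$ in $\Omega$ is a function $u$, continuous on $\overline\Omega$, with $u>0$ in $\Omega$, $u=0$ on $\partial\Omega$ and $\mathcal{P}^+_1(D^2u)+\mu_1^+u=0$ in $\Omega$. *)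

(* Defs.v *)
From HB Require Import structures.
From mathcomp Require Import all_boot all_order all_algebra.
From mathcomp Require Import all_classical all_reals all_analysis.
Set Implicit Arguments.
Unset Strict Implicit.
Unset Printing Implicit Defensive.
Import Order.TTheory GRing.Theory Num.Theory.
Import numFieldNormedType.Exports.
Local Open Scope classical_set_scope.
Local Open Scope ring_scope.

Section Defs.
Context {R : realType} {N : nat}.
Implicit Types (Omega : set 'rV[R]_N) (u phi psi : 'rV[R]_N -> R).

(* Largest eigenvalue: a symmetric real matrix has a finite spectrum, nonempty
   when 0 < N, so this supremum is a maximum. *)
Definition P1plus (X : 'M[R]_N) : R := sup [set a | eigenvalue X a].

Definition partial (i : 'I_N) (f : 'rV[R]_N -> R) : 'rV[R]_N -> R :=
  fun x => 'D_(delta_mx 0 i) f x.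

Definition hessian (f : 'rV[R]_N -> R) (x : 'rV[R]_N) : 'M[R]_N :=
  \matrix_(i, j) partial i (partial j f) x.

Definition C2_near (f : 'rV[R]_N -> R) (x0 : 'rV[R]_N) : Prop :=
  \forall x \near x0,
    [/\ {for x, continuous f},
        forall i, derivable f x (delta_mx 0 i) /\
                  {for x, continuous (partial i f)} &
        forall i j, derivable (partial j f) x (delta_mx 0 i) /\
                    {for x, continuous (partial i (partial j f))}].

(* In the viscosity definitions Omega is meant to be open, so that a
   neighbourhood of a point of Omega is a neighbourhood relative to Omega.
   Semicontinuity is not part of the two inequalities; it is required
   separately where they are used. *)

(* P_1^+(D^2 u) + mu u <= 0 in Omega *)
Definition viscosity_le0 Omega (mu : R) u : Prop :=
  forall x0 psi, Omega x0 -> C2_near psi x0 ->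
    (\forall x \near x0, u x0 - psi x0 <= u x - psi x) ->
    P1plus (hessian psi x0) + mu * u x0 <= 0.

(* P_1^+(D^2 u) + mu u >= 0 in Omega *)
Definition viscosity_ge0 Omega (mu : R) u : Prop :=
  forall x0 psi, Omega x0 -> C2_near psi x0 ->
    (\forall x \near x0, u x - psi x <= u x0 - psi x0) ->
    0 <= P1plus (hessian psi x0) + mu * u x0.

(* Supremum in the extended reals: [sup] on R would return 0 for an empty or
   unbounded set.  Lower semicontinuity is with respect to the topology induced
   on Omega; the values of phi outside Omega do not matter. *)
Definition principal_eigenvalue Omega : \bar R :=
  ereal_sup [set mu%:E | mu in
    [set mu : R | exists phi : 'rV[R]_N -> R,
      [/\ lower_semicontinuous (fun x : subspace Omega => (phi x)%:E),
          forall x, Omega x -> 0 < phi x &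
          viscosity_le0 Omega mu phi]]].

Definition principal_eigenfunction Omega u : Prop :=
  exists2 mu : R, principal_eigenvalue Omega = mu%:E &
    [/\ {within closure Omega, continuous u},
        forall x, Omega x -> 0 < u x,
        forall x, (closure Omega `\` interior Omega) x -> u x = 0,
        viscosity_le0 Omega mu u &
        viscosity_ge0 Omega mu u].

End Defs.

Definition cube {R : realType} (N : nat) (r : R) : set 'rV[R]_N :=
  [set x | forall i, - r < x 0 i < r].
Arguments cube {R} N r.

(* Main.v *)
Require Import Defs.
From HB Require Import structures.
From mathcomp Require Import all_boot all_order all_algebra.
From mathcomp Require Import all_classical all_reals all_analysis.
From mathcomp Require Import ring lra.
Set Implicit Arguments.
Unset Strict Implicit.
Unset Printing Implicit Defensive.
Import Order.TTheory GRing.Theory Num.Theory.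
Import numFieldNormedType.Exports.
Local Open Scope classical_set_scope.
Local Open Scope ring_scope.

(** With k = pi / 2r and t_i = tan (k x_i), the function u satisfies
    <D^2u(x) w, w> = u(x) (k^2/N) ((1/N) (sum_i t_i w_i)^2 - sum_i t_i^2 w_i^2 - |w|^2),
    so by Cauchy-Schwarz D^2u <= -(k^2/N) u I, with equality in a direction
    where all the t_i w_i coincide: u is a classical, hence a viscosity,
    solution.  It is thus a competitor in the definition of the principal
    eigenvalue.  Conversely, given a competitor phi for mu and a smaller
    concentric cube with its function v vanishing on the boundary, phi / v has a
    positive minimum t on that cube, attained inside, so that t v touches phi
    from below; hence mu is at most the eigenvalue of the smaller cube, and the
    latter tends to that of the full cube. *)

(** * Directional derivatives *)

Lemma near_normP (R : realType) (V : normedModType R) (P : V -> Prop) (x : V) :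
  (\forall y \near x, P y) <->
  exists2 e : R, 0 < e & forall y, `|y - x| < e -> P y.
Proof.
split=> [/nbhs_ballP[e /= e0 xe]|[e e0 xe]].
  by exists e => // y yx; apply: xe; rewrite -ball_normE /= distrC.
by apply/nbhs_ballP; exists e => //= y; rewrite -ball_normE /= distrC; exact: xe.
Qed.

Section directional_derivatives.
Context {R : realType} {V : normedModType R}.
Implicit Types (f g : V -> R) (x v w : V).

(** Both sides have the same difference quotient. One-variable results (chain rule, mean value
    theorem) thus apply along lines. *)
Lemma is_derive_lineP f x v (s d : R) :
  is_derive (s *: v + x) v f d <->
  is_derive s (1 : R) (fun t => f (t *: v + x)) d.
Proof.
have E : (fun h : R => h^-1 *: ((f \o shift (s *: v + x)) (h *: v)
             - f (s *: v + x))) =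
    (fun h : R => h^-1 *: (((fun t => f (t *: v + x)) \o shift s) (h *: 1)
             - f (s *: v + x))).
  apply/funext => h /=; congr (_ *: (f _ - _)).
  by rewrite [h *: 1]mulr1 scalerDl addrA.
by split=> -[a b]; split; rewrite /derivable /derive/= ?E in a b *.
Qed.

Lemma is_deriveZ_dir f x v (h d : R) :
  is_derive x v f d -> is_derive x (h *: v) f (h * d).
Proof.
have base u : x = 0 *: u + x by rewrite scale0r add0r.
move=> fd; have d1 : is_derive (0 : R) (1 : R) (fun t => f (t *: v + x)) d.
  by apply/is_derive_lineP; rewrite -base.
rewrite [X in is_derive X](base (h *: v)); apply/is_derive_lineP.
have -> : (fun t => f (t *: (h *: v) + x)) =
    (fun t => f (t *: v + x)) \o ( *%R h).
  by apply/funext => t /=; rewrite scalerA mulrC.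
have d2 : is_derive (0 : R) (1 : R) ( *%R h) h.
  have -> : *%R h = h \*: (@id R) by apply/funext.
  by apply: is_derive_eq; rewrite [_ *: _]mulr1.
rewrite mulrC; apply: is_derive1_comp.
by rewrite mulr0.
Qed.

(** The segment is parametrised by the fraction of [h] travelled, so that the sign of [h] does not
    matter. *)
Lemma line_MVT f x v (h : R) :
  (forall t : R, 0 <= t <= 1 -> derivable f ((t * h) *: v + x) v) ->
  exists2 c : R, 0 < c < 1 &
    f (h *: v + x) - f x = h * 'D_v f ((c * h) *: v + x).
Proof.
move=> df.
pose g (s : R) : R := f (s *: (h *: v) + x).
have dg (t : R) : 0 <= t <= 1 ->
    is_derive t (1 : R) g (h * 'D_v f ((t * h) *: v + x)).
  move=> t01; apply/is_derive_lineP; rewrite scalerA.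
  by apply: is_deriveZ_dir; apply/derivableP/df.
have dgo (t : R) : t \in `]0, 1[ ->
    is_derive t (1 : R) g (h * 'D_v f ((t * h) *: v + x)).
  by rewrite in_itv/= => /andP[/ltW t0 /ltW t1]; apply: dg; rewrite t0.
have cg : {within `[0, 1], continuous g}.
  by apply: derivable_within_continuous => t; rewrite in_itv/= => /dg[].
have [c] := MVT ltr01 dgo cg.
rewrite in_itv/= /g scale1r scale0r add0r subr0 mulr1 => c01 fE.
by exists c.
Qed.

(** The increment is split into a leg along [h *: v] and one along [h *: w]. The first quotient
    converges by hypothesis; the second is a value of ['D_w f] near [x] by the mean value theorem,
    and converges by continuity. *)
Lemma is_deriveD_dir f x v w :
  derivable f x v -> (\forall y \near x, derivable f y w) ->
  {for x, continuous ('D_w f)} ->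
  is_derive x (v + w) f ('D_v f x + 'D_w f x).
Proof.
move=> dv dw cw.
suff qcvg : (fun h : R => h^-1 *: ((f \o shift x) (h *: (v + w)) - f x)) @ 0^'
    --> 'D_v f x + 'D_w f x.
  by split; [apply/cvg_ex; exists ('D_v f x + 'D_w f x) | exact/cvg_lim].
pose q (h : R) := h^-1 *: ((f \o shift x) (h *: v) - f x).
pose p (h : R) := h^-1 *: (f (h *: w + (h *: v + x)) - f (h *: v + x)).
have -> : (fun h : R => h^-1 *: ((f \o shift x) (h *: (v + w)) - f x)) =
    q \+ p.
  apply/funext => h; rewrite /q /p /= -scalerDr; congr (_ *: _).
  by rewrite [RHS]addrC addrA subrK scalerDr addrA [_ *: w + _]addrC.
apply: cvgD; first exact: dv.
apply/cvgrPdist_lt => e e0.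
have [d1 d10 Hd1] := (near_normP _ _).1 dw.
have [d2 d20 Hd2] := (near_normP _ _).1 ((cvgrPdist_lt _ _).1 cw e e0).
pose d := Num.min d1 d2; have d0 : 0 < d by rewrite lt_min d10.
(* [M] bounds the total displacement per unit of [h], and the [+ 1] keeps it positive. *)
pose M := `|v| + `|w| + 1; have M0 : 0 < M by rewrite ltr_wpDl// addr_ge0.
have small (h t : R) : `|h| < d / M -> 0 <= t <= 1 ->
    `|(t * h) *: w + (h *: v + x) - x| < d.
  move=> hd /andP[t0 t1]; rewrite addrA addrK.
  have hM : `|h| * M < d by rewrite -ltr_pdivlMr.
  apply: le_lt_trans hM; apply: le_trans (ler_normD _ _) _.
  rewrite !normrZ /M !mulrDr mulr1 (ger0_norm t0).
  have : t * `|h| * `|w| <= `|h| * `|w|.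
    by rewrite -mulrA ler_piMl// mulr_ge0.
  by have := normr_ge0 h; lra.
have dM0 : 0 < d / M by rewrite divr_gt0.
near=> h.
have h0 : h != 0 by near: h; exact: nbhs_dnbhs_neq.
have hd : `|h| < d / M.
  near: h; apply: dnbhs0_lt; exact: dM0.
have [|c /andP[c0 c1]] := @line_MVT f (h *: v + x) w h.
  by move=> t t01; apply: Hd1; apply: lt_le_trans (small h t hd t01) _;
     rewrite ge_min lexx.
rewrite /p => ->; rewrite [_ *: _]mulrA mulVf// mul1r.
apply: Hd2; apply: lt_le_trans (small h c hd _) _; first by rewrite !ltW.
by rewrite ge_min lexx orbT.
Unshelve. all: by end_near. Qed.

(** The first derivative vanishes at the minimum. Were the second one negative, ['D_v f] would be
    negative just after [x], and the mean value theorem would make [f] drop below [f x]. *)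
Lemma derive2_local_min f x v :
  (\forall y \near x, derivable f y v) -> derivable ('D_v f) x v ->
  (\forall y \near x, f x <= f y) -> 0 <= 'D_v ('D_v f) x.
Proof.
move=> df ddf fmin.
have [e e0 He] : exists2 e : R, 0 < e &
    forall y, `|y - x| < e -> derivable f y v /\ f x <= f y.
  by apply/near_normP; near=> y; split; near: y.
pose M := `|v| + 1; have M0 : 0 < M by rewrite ltr_wpDl.
have small (t : R) : `|t| < e / M -> `|t *: v + x - x| < e.
  move=> te; rewrite addrK normrZ.
  have tM : `|t| * M < e by rewrite -ltr_pdivlMr.
  by apply: le_lt_trans tM; rewrite ler_wpM2l// /M lerDl.
have d0 : 0 < e / M by rewrite divr_gt0.
have df0 : 'D_v f x = 0.
  have [] := @derive1_at_min R (fun t => f (t *: v + x)) (- (e / M)) (e / M) 0.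
  - by rewrite ltW// (lt_trans _ d0)// oppr_lt0.
  - move=> t; rewrite in_itv/= -ltr_norml => /small/He[+ _].
    by move=> /derivableP/is_derive_lineP[].
  - by rewrite in_itv/= oppr_lt0 d0.
  - move=> t; rewrite in_itv/= -ltr_norml => /small/He[_].
    by rewrite scale0r add0r.
  move=> _ <-; symmetry.
  have [_ ] : is_derive (0 : R) (1 : R) (fun t => f (t *: v + x)) ('D_v f x) => //.
  apply/is_derive_lineP; rewrite scale0r add0r; apply/derivableP.
  by have [] := He x; rewrite ?subrr ?normr0.
rewrite leNgt; apply/negP => neg.
have : \forall h \near 0^', h^-1 *: (('D_v f \o shift x) (h *: v) - 'D_v f x) < 0.
  exact: (cvgr_lt _ ddf).
rewrite df0 /dnbhs => /near_normP [a a0 Ha].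
have [h h0 hm] : exists2 h, 0 < h & h < Num.min a (e / M).
  have m0 : 0 < Num.min a (e / M) by rewrite lt_min a0.
  exists (Num.min a (e / M) / 2); first by rewrite divr_gt0.
  by rewrite ltr_pdivrMr// ltr_pMr// ltr1n.
have hle (t : R) : 0 <= t <= 1 -> `|t * h| < Num.min a (e / M).
  move=> /andP[t0 t1]; have h0' := ltW h0.
  by rewrite ger0_norm ?mulr_ge0//; apply: le_lt_trans hm; rewrite ler_piMl.
have [|c /andP[c0 c1]] := @line_MVT f x v h.
  move=> t t01; have [] // := He ((t * h) *: v + x); apply: small.
  by apply: lt_le_trans (hle t t01) _; rewrite ge_min lexx orbT.
have ch0 : 0 < c * h by rewrite mulr_gt0.
have ch : `|c * h| < a.
  have c01 : 0 <= c <= 1 by rewrite !ltW.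
  by apply: lt_le_trans (hle c c01) _; rewrite ge_min lexx.
have := Ha (c * h); rewrite subr0 => /(_ ch) /=.
rewrite subr0 gt_eqF// => /(_ isT).
rewrite [X in X < 0](_ : _ = (c * h)^-1 * 'D_v f ((c * h) *: v + x))//.
rewrite pmulr_rlt0 ?invr_gt0// => neg' fE.
have : f (h *: v + x) - f x < 0 by rewrite fE pmulr_rlt0.
rewrite subr_lt0 ltNge => /negP; apply.
have [] // := He (h *: v + x); apply: small.
rewrite ger0_norm ?(ltW h0)//; apply: lt_le_trans hm _.
by rewrite ge_min lexx orbT.
Unshelve. all: by end_near. Qed.

Lemma is_derive_translate f a x v (d : R) :
  is_derive (a + x) v f d -> is_derive x v (fun y => f (a + y)) d.
Proof.
have E : (fun h : R => h^-1 *: ((f \o shift (a + x)) (h *: v) - f (a + x))) =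
    (fun h : R => h^-1 *: (((fun y => f (a + y)) \o shift x) (h *: v)
             - f (a + x))).
  by apply/funext => h /=; rewrite addrCA.
by move=> [c l]; split; rewrite /derivable /derive/= -E.
Qed.

(** The mean value theorem is used twice: along [v] for the increment [y |-> f (h *: w + y) - f y],
    then along [w] for ['D_v f]. *)
Lemma second_difference f x v w (h : R) :
  (forall s t : R, 0 <= s <= 1 -> 0 <= t <= 1 ->
    derivable f ((t * h) *: w + ((s * h) *: v + x)) v /\
    derivable ('D_v f) ((t * h) *: w + ((s * h) *: v + x)) w) ->
  exists s t : R, [/\ 0 <= s <= 1, 0 <= t <= 1 &
    f (h *: w + (h *: v + x)) - f (h *: v + x) - (f (h *: w + x) - f x) =
    h * (h * 'D_w ('D_v f) ((t * h) *: w + ((s * h) *: v + x)))].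
Proof.
move=> df; pose g y := f (h *: w + y) - f y.
have i0 : 0 <= (0 : R) <= 1 by rewrite lexx ler01.
have i1 : 0 <= (1 : R) <= 1 by rewrite ler01 lexx.
have dg (s : R) : 0 <= s <= 1 -> is_derive ((s * h) *: v + x) v g
    ('D_v f (h *: w + ((s * h) *: v + x)) - 'D_v f ((s * h) *: v + x)).
  move=> s01.
  have [] := df s 1 s01 i1; rewrite mul1r => d1 _.
  have [] := df s 0 s01 i0; rewrite mul0r scale0r add0r => d0 _.
  apply: is_deriveB; last exact: derivableP.
  apply: is_derive_translate; exact: derivableP.
have [|s /andP[s0 s1]] := @line_MVT g x v h.
  move=> s s01; by have [] := dg s s01.
have s01 : 0 <= s <= 1 by rewrite !ltW.
have [_ ->] := dg s s01.
have [|t /andP[t0 t1]] := @line_MVT ('D_v f) ((s * h) *: v + x) w h.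
  move=> t t01; by have [] := df s t s01 t01.
rewrite /g => E1 E2; exists s, t; split; rewrite ?s01 ?ltW//.
by rewrite E2 E1.
Qed.


(** The second difference is symmetric in [v] and [w], so a value of one mixed derivative equals a
    value of the other at points close to [x]. A gap [D] at [x] is then impossible, both being
    within [D / 2] of this common value. *)
Lemma derive_dirC f x v w :
  (\forall y \near x, derivable f y v) -> (\forall y \near x, derivable f y w) ->
  (\forall y \near x, derivable ('D_v f) y w) ->
  (\forall y \near x, derivable ('D_w f) y v) ->
  {for x, continuous ('D_v ('D_w f))} -> {for x, continuous ('D_w ('D_v f))} ->
  'D_v ('D_w f) x = 'D_w ('D_v f) x.
Proof.
move=> dv dw dvw dwv cvw cwv.
apply/eqP; rewrite -subr_eq0 -normr_le0 leNgt; apply/negP.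
move DE : `|_| => D D0.
have D20 : 0 < D / 2 by rewrite divr_gt0.
have [e e0 He] : exists2 e : R, 0 < e & forall y, `|y - x| < e ->
    [/\ derivable f y v, derivable f y w, derivable ('D_v f) y w,
        derivable ('D_w f) y v &
        `|'D_v ('D_w f) x - 'D_v ('D_w f) y| < D / 2 /\
        `|'D_w ('D_v f) x - 'D_w ('D_v f) y| < D / 2].
  apply/near_normP.
  have cvw' : \forall y \near x, `|'D_v ('D_w f) x - 'D_v ('D_w f) y| < D / 2.
    exact: (cvgrPdist_lt _ _).1 cvw _ D20.
  have cwv' : \forall y \near x, `|'D_w ('D_v f) x - 'D_w ('D_v f) y| < D / 2.
    exact: (cvgrPdist_lt _ _).1 cwv _ D20.
  apply: filterS (filterI (filterI dv dw)
    (filterI (filterI dvw dwv) (filterI cvw' cwv'))).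
  by move=> y [[a b] [[c d] [cd1 cd2]]].
pose M := `|v| + `|w| + 1; have M0 : 0 < M by rewrite ltr_wpDl// addr_ge0.
have [h h0 hM] : exists2 h, 0 < h & h * M < e.
  exists (e / M / 2); first by rewrite !divr_gt0.
  by rewrite mulrAC divfK ?gt_eqF// ltr_pdivrMr// ltr_pMr// ltr1n.
have small (s t : R) : 0 <= s <= 1 -> 0 <= t <= 1 ->
    `|(s * h) *: v + ((t * h) *: w + x) - x| < e.
  move=> /andP[s0 s1] /andP[t0 t1]; rewrite addrA addrK.
  apply: le_lt_trans hM; apply: le_trans (ler_normD _ _) _.
  rewrite !normrZ !ger0_norm ?mulr_ge0// ?ltW// /M.
  have : s * (h * `|v|) <= h * `|v| by rewrite ler_piMl// mulr_ge0// ltW.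
  have : t * (h * `|w|) <= h * `|w| by rewrite ler_piMl// mulr_ge0// ltW.
  by move: h0; lra.
have i0 : 0 <= (0 : R) <= 1 by rewrite lexx ler01.
have i1 : 0 <= (1 : R) <= 1 by rewrite ler01 lexx.
have comm y a b : (a *: v + (b *: w + y)) = (b *: w + (a *: v + y)) :> V.
  by rewrite addrCA.
have [s [t [s01 t01 E1]]] : exists s t : R, [/\ 0 <= s <= 1, 0 <= t <= 1 &
    f (h *: w + (h *: v + x)) - f (h *: v + x) - (f (h *: w + x) - f x) =
    h * (h * 'D_w ('D_v f) ((t * h) *: w + ((s * h) *: v + x)))].
  apply: second_difference => s t s01 t01; rewrite -comm.
  by have [d1 _ d3 _ _] := He _ (small s t s01 t01); split.
have [s' [t' [s'01 t'01 E2]]] : exists s t : R, [/\ 0 <= s <= 1, 0 <= t <= 1 &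
    f (h *: v + (h *: w + x)) - f (h *: w + x) - (f (h *: v + x) - f x) =
    h * (h * 'D_v ('D_w f) ((t * h) *: v + ((s * h) *: w + x)))].
  apply: second_difference => s' t' s01' t01'.
  by have [_ d2 _ d4 _] := He _ (small t' s' t01' s01'); split.
have [_ _ _ _ [_ B1]] := He _ (small s t s01 t01).
have [_ _ _ _ [B2 _]] := He _ (small t' s' t'01 s'01).
rewrite comm in B1; move: E1; rewrite -comm => E1.
(* Exchanging the two middle terms identifies the two second differences; the nonzero [h] is then
   cancelled twice. *)
have : h * (h * 'D_w ('D_v f) ((t * h) *: w + ((s * h) *: v + x))) =
    h * (h * 'D_v ('D_w f) ((t' * h) *: v + ((s' * h) *: w + x))).
  have ac (a b c d : R) : a - b - (c - d) = a - c - (b - d) by ring.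
  exact: etrans (esym E1) (etrans (ac _ _ _ _) E2).
move/(mulfI (lt0r_neq0 h0))/(mulfI (lt0r_neq0 h0)) => EE.
move: DE B1 B2; rewrite {}EE.
have tri (a b c : R) : `|a - b| = D -> `|b - c| < D / 2 ->
    `|a - c| < D / 2 -> False.
  move=> <- bc ac; have := ler_distD c a b.
  by rewrite leNgt => /negP; apply; rewrite [ltRHS]splitr ltrD// distrC.
exact: tri.
Qed.

End directional_derivatives.

(** * The largest eigenvalue as a Rayleigh quotient *)

Section rayleigh.
Context {R : realType} {N : nat}.
Implicit Types (X : 'M[R]_N) (v w : 'rV[R]_N).

Definition dot v w : R := (v *m w^T) 0 0.

Lemma dotE v w : dot v w = \sum_i v 0 i * w 0 i.
Proof. by rewrite /dot mxE; apply: eq_bigr => i _; rewrite mxE. Qed.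

Lemma dotC v w : dot v w = dot w v.
Proof. by rewrite !dotE; apply: eq_bigr => i _; rewrite mulrC. Qed.

Lemma dotDl u v w : dot (u + v) w = dot u w + dot v w.
Proof. by rewrite /dot mulmxDl mxE. Qed.

Lemma dotZl a v w : dot (a *: v) w = a * dot v w.
Proof. by rewrite /dot -scalemxAl mxE. Qed.

Lemma dotDr u v w : dot u (v + w) = dot u v + dot u w.
Proof. by rewrite dotC dotDl !(dotC u). Qed.

Lemma dotZr a v w : dot v (a *: w) = a * dot v w.
Proof. by rewrite dotC dotZl dotC. Qed.

Lemma dot_ge0 v : 0 <= dot v v.
Proof. by rewrite dotE sumr_ge0// => i _; rewrite -expr2 sqr_ge0. Qed.

Lemma dot_eq0 v : (dot v v == 0) = (v == 0).
Proof.
apply/eqP/eqP => [|->]; last by rewrite /dot mul0mx mxE.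
rewrite dotE => /eqP; rewrite psumr_eq0 => [/allP v0|i _]; last first.
  by rewrite -expr2 sqr_ge0.
apply/rowP => i; have := v0 i (mem_index_enum _).
by rewrite /= mulf_eq0 orbb mxE => /eqP.
Qed.

Lemma dot_gt0 v : v != 0 -> 0 < dot v v.
Proof. by move=> v0; rewrite lt_def dot_ge0 dot_eq0 v0. Qed.

Lemma dot_mul_sym X v w : X^T = X -> dot (v *m X) w = dot (w *m X) v.
Proof.
by move=> Xs; rewrite dotC [LHS]/dot [RHS]/dot trmx_mul Xs mulmxA.
Qed.

Lemma dot_mx_continuous X : continuous (fun v => dot (v *m X) v).
Proof.
have -> : (fun v => dot (v *m X) v) =
    (fun v => \sum_j (\sum_i v 0 i * X i j) * v 0 j).
  by apply/funext => v; rewrite dotE; apply: eq_bigr => j _; rewrite mxE.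
apply: continuous_big => [|j _ v]; first exact: add_continuous.
apply: continuousM; last exact: coord_continuous.
apply: (continuous_big add_continuous) => i _ {}v.
by apply: continuousM; [exact: coord_continuous | exact: cst_continuous].
Qed.

(** The ambient norm is the maximum norm, so boundedness is checked entrywise: each squared entry is
    one term of the sum equal to 1. *)
Lemma compact_unit_sphere : compact [set v | dot v v = 1].
Proof.
apply: bounded_closed_compact.
  exists 1; split; first exact: num_real.
  move=> M M1 v /= v1; apply: le_trans (ltW M1).
  rewrite [leLHS]/Num.Def.normr /= mx_normrE; apply/bigmax_leP; split => // -[i j] _ /=.
  rewrite (ord1 i) -(@ler_pXn2r _ 2) ?nnegrE// expr1n -v1 dotE (bigD1 j)//=.
  rewrite real_normK ?num_real// expr2 lerDl sumr_ge0// => k _.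
  by rewrite -expr2 sqr_ge0.
apply: (@preimage_closed _ _ (fun v => dot v v) [set 1]); last exact: closed_eq.
move=> v _; rewrite (_ : (fun v => dot v v) = (fun v => dot (v *m 1%:M) v)).
  exact: dot_mx_continuous.
by apply/funext => w; rewrite mulmx1.
Qed.

(* At a maximum point of the Rayleigh quotient the form
   a |v|^2 - <v X, v> is nonnegative and vanishes, hence so does its gradient. *)
Lemma max_rayleigh X : (0 < N)%N -> X^T = X ->
  exists a : R, eigenvalue X a /\ forall w, dot (w *m X) w <= a * dot w w.
Proof.
move=> N0 Xs.
have [||v] := @compact_EVT_max _ _ (fun v => dot (v *m X) v)
    [set v | dot v v = 1] _ compact_unit_sphere.
- exists (delta_mx 0 (Ordinal N0)) => /=.
  rewrite dotE (bigD1 (Ordinal N0))//= big1 ?mxE ?eqxx ?mulr1 ?addr0// => i i0.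
  by rewrite !mxE (negbTE i0) andbF mulr0.
- exact/continuous_subspaceT/dot_mx_continuous.
rewrite inE /= => v1 vmax; pose a := dot (v *m X) v; exists a.
have aP w : dot (w *m X) w <= a * dot w w.
  have [->|w0] := eqVneq w 0; first by rewrite mul0mx /dot !mul0mx mxE mulr0.
  have ww := dot_gt0 w0; pose s := Num.sqrt (dot w w).
  have ss : s * s = dot w w by rewrite -expr2 sqr_sqrtr// ltW.
  have s0 : s != 0 by rewrite gt_eqF// sqrtr_gt0.
  have /vmax : s^-1 *: w \in [set v | dot v v = 1].
    by rewrite inE /= dotZl dotZr -ss; field.
  rewrite -scalemxAl dotZl dotZr mulrA -invfM ss -/a => h.
  by move: h; rewrite mulrC ler_pdivrMr.
split=> //; apply/eigenvalueP; exists v; last first.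
  by apply: contra_eqN v1 => /eqP->; rewrite /dot mul0mx mxE eq_sym oner_eq0.
apply/eqP; rewrite -subr_eq0 -dot_eq0; move wE : (_ - _) => w.
pose B := dot (v *m X) w - a * dot v w.
have BE : B = dot w w.
  by rewrite -{1}wE dotDl -scaleNr dotZl mulNr.
pose C := a * dot w w - dot (w *m X) w.
have C0 : 0 <= C by rewrite subr_ge0.
(* This is the nonnegativity of [a |v|^2 - <v X, v>] at [v + t *: w], expanded in [t]; the constant
   term vanishes by the choice of [a]. *)
have key (t : R) : 2 * t * B <= t ^+ 2 * C.
  have := aP (v + t *: w).
  rewrite mulmxDl -scalemxAl !(dotDl, dotDr, dotZl, dotZr) v1.
  rewrite (dot_mul_sym w v Xs) (dotC w v) -/a /B /C; nra.
rewrite -BE; apply/eqP/le_anti; rewrite [X in _ && (_ <= X)]BE dot_ge0 andbT.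
(* A minimiser of the quadratic would be [B / C]; the shift by 1 allows [C = 0] and still yields
   [2 (C + 1) B^2 <= C B^2], hence [B = 0]. *)
have := key (B / (C + 1)).
have C1 : C + 1 != 0 by rewrite gt_eqF// ltr_wpDl.
rewrite -(ler_pM2r (_ : 0 < (C + 1) ^+ 2)) ?exprn_gt0 ?ltr_wpDl//.
have -> : 2 * (B / (C + 1)) * B * (C + 1) ^+ 2 = 2 * (C + 1) * B ^+ 2 by field.
have -> : (B / (C + 1)) ^+ 2 * C * (C + 1) ^+ 2 = B ^+ 2 * C by field.
move=> h; rewrite leNgt; apply/negP => B0; have : 0 < B ^+ 2 by rewrite exprn_gt0.
by move: h C0; nra.
Qed.

(** An eigenvalue is the Rayleigh quotient of its eigenvector; [max_rayleigh] makes the spectrum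
    nonempty, so that [sup] does not take its default value. *)
Lemma P1plus_le X (c : R) : (0 < N)%N -> X^T = X ->
  (forall w, dot (w *m X) w <= c * dot w w) -> P1plus X <= c.
Proof.
move=> N0 Xs Xc; apply: ge_sup.
  by have [a [aX _]] := max_rayleigh N0 Xs; exists a.
move=> a /= /eigenvalueP[v vX v0].
by have := Xc v; rewrite vX dotZl ler_pM2r// dot_gt0.
Qed.

(** The eigenvalue from [max_rayleigh] dominates every Rayleigh quotient, and also bounds the
    spectrum, so that [sup] is a true supremum. *)
Lemma P1plus_ge X (c : R) w : (0 < N)%N -> X^T = X -> w != 0 ->
  c * dot w w <= dot (w *m X) w -> c <= P1plus X.
Proof.
move=> N0 Xs w0 Xc; have [a [aX aP]] := max_rayleigh N0 Xs.
apply: (@le_trans _ _ a).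
  by rewrite -(ler_pM2r (dot_gt0 w0)) (le_trans Xc).
apply: ub_le_sup => //; exists a => b /= /eigenvalueP[v vX v0].
by have := aP v; rewrite vX dotZl ler_pM2r// dot_gt0.
Qed.

End rayleigh.

(** * Products of functions of one coordinate *)

Lemma near_eq_continuous (T U : topologicalType) (f g : T -> U) (x : T) :
  (\forall y \near x, f y = g y) -> {for x, continuous f} ->
  {for x, continuous g}.
Proof.
move=> fg cf; rewrite /prop_for /continuous_at -(nbhs_singleton fg).
apply: cvg_trans cf; apply: near_eq_cvg.
by apply: filterS fg => y ->.
Qed.

Section separable_functions.
Context {R : realType} {N : nat}.
Context (c : R) (gs : nat -> R -> R) (D : set R).
Context (openD : open D).
Context (gs_derive : forall n s, (n < 2)%N -> D s ->
  is_derive s (1 : R) (gs n) (gs n.+1 s)).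
Context (gs2_continuous : forall s, D s -> {for s, continuous (gs 2)}).

(** On [D], [gs n] stands for the n-th derivative of one profile, and [k i] counts the derivatives
    taken in coordinate [i]: a partial derivative raises one entry of [k]. *)
Definition sepf (k : 'I_N -> nat) (x : 'rV[R]_N) : R :=
  c * \prod_i gs (k i) (x 0 i).

Definition incr (j : 'I_N) (k : 'I_N -> nat) (i : 'I_N) : nat :=
  ((i == j) + k i)%N.

Definition box : set 'rV[R]_N := [set x | forall i, D (x 0 i)].

Lemma box_nbhs x : box x -> \forall y \near x, box y.
Proof.
move=> xD; have : forall i : 'I_N, \forall y \near x, D ((y : 'rV[R]_N) 0 i); last first.
  by move/filter_forall.
move=> i.
by have /(_ D) := @coord_continuous R 1 N 0 i x; apply; exact: open_nbhs_nbhs.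
Qed.

Lemma gs_continuous n s : (n <= 2)%N -> D s -> {for s, continuous (gs n)}.
Proof.
rewrite leq_eqVlt => /predU1P[->|n2] Ds; first exact: gs2_continuous.
by apply/differentiable_continuous/derivable1_diffP; have [] := gs_derive n2 Ds.
Qed.

Lemma sepf_continuous k x : (forall i, k i <= 2)%N -> box x ->
  {for x, continuous (sepf k)}.
Proof.
move=> k2 xD; apply: continuousM; first exact: cst_continuous.
have cg i : gs (k i) ((y : 'rV[R]_N) 0 i) @[y --> x] --> gs (k i) (x 0 i).
  apply: (@continuous_comp _ _ _ (fun y : 'rV[R]_N => y 0 i) (gs (k i))).
    exact: coord_continuous.
  exact: gs_continuous.
exact: (@cvg_big _ _ _ _ _ mul_continuous _ (nbhs x)).
Qed.

Lemma sepf_derive k j x : (k j < 2)%N -> box x ->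
  is_derive x (delta_mx 0 j) (sepf k) (sepf (incr j k) x).
Proof.
move=> k2 xD.
rewrite -[X in is_derive X]add0r -(scale0r (delta_mx 0 j)).
apply/is_derive_lineP.
pose C := c * \prod_(i | i != j) gs (k i) (x 0 i).
have -> : (fun t => sepf k (t *: delta_mx 0 j + x)) =
    C \*: (fun t => gs (k j) (x 0 j + t)).
  apply/funext => t; rewrite /sepf (bigD1 j)//= !mxE !eqxx mulr1 addrC.
  rewrite [RHS](_ : _ = C * gs (k j) (x 0 j + t))// /C -mulrA; congr (_ * _).
  rewrite mulrC; congr (_ * _); apply: eq_bigr => i ij.
  by rewrite !mxE (negbTE ij) andbF mulr0 add0r.
have -> : sepf (incr j k) x = C *: gs (k j).+1 (x 0 j + 0).
  rewrite /sepf (bigD1 j)//= /incr eqxx add1n addr0.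
  rewrite [RHS](_ : _ = C * gs (k j).+1 (x 0 j))// /C -mulrA; congr (_ * _).
  rewrite mulrC; congr (_ * _); apply: eq_bigr => i ij.
  by rewrite (negbTE ij).
apply: is_deriveZ; apply: is_derive_translate.
by rewrite addr0; exact: gs_derive.
Qed.

Let k0 : 'I_N -> nat := fun=> 0%N.

Lemma partial_sepf j x : box x ->
  partial j (sepf k0) x = sepf (incr j k0) x.
Proof. by move=> xD; have [] := @sepf_derive k0 j x isT xD. Qed.

Lemma near_partial_sepf j x : box x ->
  \forall y \near x, sepf (incr j k0) y = partial j (sepf k0) y.
Proof.
by move=> /box_nbhs; apply: filterS => y yD; rewrite partial_sepf.
Qed.

(** The formula for the first partial derivative holds on a whole neighbourhood, [box] being open,
    and can therefore be differentiated again. *)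
Lemma partial2_sepf i j x : box x ->
  is_derive x (delta_mx 0 i) (partial j (sepf k0)) (sepf (incr i (incr j k0)) x).
Proof.
move=> xD; apply: near_eq_is_derive; first exact: (near_partial_sepf j xD).
by apply: sepf_derive => //; rewrite /incr /k0 addn0; case: eqP.
Qed.

Lemma near_partial2_sepf i j x : box x ->
  \forall y \near x, sepf (incr i (incr j k0)) y =
    partial i (partial j (sepf k0)) y.
Proof.
move=> /box_nbhs; apply: filterS => y yD.
by have [] := partial2_sepf i j yD.
Qed.

Lemma C2_near_sepf x : box x -> C2_near (sepf k0) x.
Proof.
move=> /box_nbhs; apply: filterS => y yD; split=> [|i|i j].
- exact: sepf_continuous.
- split; first by have [] := @sepf_derive k0 i y isT yD.
  apply: near_eq_continuous (near_partial_sepf i yD) _.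
  by apply: sepf_continuous => // l; rewrite /incr; case: eqP.
- split; first by have [] := partial2_sepf i j yD.
  apply: near_eq_continuous (near_partial2_sepf i j yD) _.
  by apply: sepf_continuous => // l; rewrite /incr; do 2 case: eqP.
Qed.

(** With [p = g'/g] and [q = g''/g], the Hessian is the function times a rank-one matrix [p_i p_j]
    plus the diagonal matrix [q_i - p_i^2]. *)
Lemma hessian_sepf x (p q : R -> R) : box x ->
  (forall s, D s -> gs 1 s = p s * gs 0 s) ->
  (forall s, D s -> gs 2 s = q s * gs 0 s) ->
  forall w, dot (w *m hessian (sepf k0) x) w =
    sepf k0 x * ((\sum_i w 0 i * p (x 0 i)) ^+ 2 +
      \sum_i (q (x 0 i) - p (x 0 i) ^+ 2) * w 0 i ^+ 2).
Proof.
move=> xD gp gq w.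
have HE i j : hessian (sepf k0) x i j = sepf k0 x *
    (p (x 0 i) * p (x 0 j) +
     (i == j)%:R * (q (x 0 i) - p (x 0 i) ^+ 2)).
  rewrite mxE; have [_] := partial2_sepf i j xD; rewrite /partial => ->.
  rewrite /sepf -!mulrA; congr (_ * _).
  rewrite (bigD1 i)//= [in RHS](bigD1 i)//= /incr eqxx.
  have [->|ij] := eqVneq i j.
    rewrite addn0 /= gq// (eq_bigr (fun l => gs 0 (x 0 l))); last first.
      by move=> l lj; rewrite (negbTE lj).
    by rewrite /k0 /=; ring.
  rewrite addn0 /= gp//.
  rewrite (bigD1 j) 1?eq_sym//= [in RHS](bigD1 j) 1?eq_sym//= eqxx.
  rewrite [in LHS]eq_sym (negbTE ij) /= gp//.
  rewrite (eq_bigr (fun l => gs 0 (x 0 l))); last first.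
    by move=> l /andP[li lj]; rewrite (negbTE li) (negbTE lj).
  by rewrite /k0 /=; ring.
rewrite dotE.
under eq_bigr => j _ do rewrite mxE.
rewrite mulrDr expr2 {1}mulr_suml !mulr_sumr -big_split/=.
apply: eq_bigr => j _; rewrite mulr_suml !mulr_sumr.
under eq_bigr => i _ do rewrite HE mulrDr mulrDr mulrDl.
rewrite big_split/=; congr (_ + _).
  have ac (a b d e f : R) : a * (f * (d * e)) * b = f * (b * e * (a * d)).
    by ring.
  by apply: eq_bigr => i _; exact: ac.
rewrite (bigD1 j)//= big1 => [|i ij]; last first.
  by rewrite (negbTE ij) mul0r !mulr0 mul0r.
have ac (a b d : R) : a * (b * d) * a + 0 = b * (d * a ^+ 2) by ring.
by rewrite eqxx mul1r; exact: ac.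
Qed.

End separable_functions.

(** * The product of roots of cosines *)

Section cosine_roots.
Context {R : realType}.
Context (a k : R).
Implicit Type s : R.

(** The function [cos (k s) ^ a] and its first two derivatives, with the power factored out so that
    the prefactors are the [p] and [q] of [hessian_sepf]. Indices above 2 default to the second
    derivative. *)
Definition cosroot (n : nat) s : R :=
  match n with
  | 0 => 1
  | 1 => - (a * k) * tan (k * s)
  | _ => (a * k) ^+ 2 * tan (k * s) ^+ 2 - a * k ^+ 2 * (1 + tan (k * s) ^+ 2)
  end * cos (k * s) `^ a.

Lemma cosroot0E : cosroot 0 = (fun s => cos (k * s) `^ a).
Proof. by apply/funext => s; rewrite /cosroot mul1r. Qed.

Definition cospos : set R := [set s | 0 < cos (k * s)].

Let is_derive_scale s : is_derive s (1 : R) ( *%R k) k.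
Proof.
have -> : *%R k = k \*: (@id R) by apply/funext.
by apply: is_derive_eq; rewrite [_ *: _]mulr1.
Qed.

Lemma open_cospos : open cospos.
Proof.
apply: (@open_comp _ _ (fun s => cos (k * s)) [set y | 0 < y]).
  move=> s _; apply: (@continuous_comp _ _ _ ( *%R k) cos).
    exact: mulrl_continuous.
  exact: continuous_cos.
exact: open_gt.
Qed.

Lemma is_derive_tan_scale s : cospos s ->
  is_derive s (1 : R) (fun s => tan (k * s)) ((1 + tan (k * s) ^+ 2) * k).
Proof.
move=> cs; rewrite -cos2_tan2 ?gt_eqF//.
apply: (@is_derive1_comp _ tan ( *%R k)); last exact: is_derive_scale.
by apply: is_derive_tan; rewrite gt_eqF.
Qed.

Lemma is_derive_cosroot n s : (n < 2)%N -> cospos s ->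
  is_derive s (1 : R) (cosroot n) (cosroot n.+1 s).
Proof.
have d0 s' : cospos s' ->
    is_derive s' (1 : R) (fun y => cos (k * y) `^ a) (cosroot 1 s').
  move=> cs.
  rewrite [X in is_derive _ _ X](_ : _ = (fun y => y `^ a) \o (cos \o *%R k))//.
  have dc : is_derive s' (1 : R) (cos \o *%R k) (- sin (k * s') * k).
    by apply: is_derive1_comp; exact: is_derive_scale.
  have dp : is_derive ((cos \o *%R k) s') (1 : R) (fun y => y `^ a)
     (a * cos (k * s') `^ (a - 1)).
    exact: (@is_derive1_powR _ a _ cs).
  apply: is_derive_eq.
  rewrite (_ : _ `^ (a - 1) = cos (k * s') `^ a / cos (k * s')); last first.
    by rewrite powRB ?powRr1 ?(ltW cs)// (gt_eqF cs) implybT.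
  by rewrite /cosroot /tan /=; field; rewrite gt_eqF.
case: n => [_ | [_ |//]] cs; first by rewrite cosroot0E; exact: d0.
rewrite [X in is_derive _ _ X](_ : _ =
  (- (a * k) \*: (fun y => tan (k * y))) * (fun y => cos (k * y) `^ a)); last first.
  by apply/funext.
have dt := is_derive_tan_scale cs; have dc := d0 _ cs.
apply: is_derive_eq; rewrite /cosroot.
by rewrite ![_ *: _]mulrC [(_ \*: _) s](_ : _ = - (a * k) * tan (k * s))//; ring.
Qed.

Lemma cosroot2_continuous s : cospos s -> {for s, continuous (cosroot 2)}.
Proof.
move=> cs.
have ct : {for s, continuous (fun s => tan (k * s))}.
  apply/differentiable_continuous/derivable1_diffP.
  by have [] := is_derive_tan_scale cs.
have ct2 : {for s, continuous (fun s => tan (k * s) ^+ 2)}.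
  by apply: continuousM.
have c0 : {for s, continuous (fun s => cos (k * s) `^ a)}.
  rewrite -cosroot0E.
  apply/differentiable_continuous/derivable1_diffP.
  by have [] := @is_derive_cosroot 0 s isT cs.
apply: continuousM => //; apply: continuousB.
  by apply: continuousM => //; exact: cst_continuous.
apply: continuousM; first exact: cst_continuous.
by apply: continuousD => //; exact: cst_continuous.
Qed.

End cosine_roots.

(** * Hessian of the product of roots of cosines *)

Section cosine_products.
Context {R : realType} {N : nat}.
Context (c k : R).
Implicit Types x w : 'rV[R]_N.

(** The factor [c] lets the multiples used as test functions share the lemmas on the
    eigenfunction. *)
Definition cosprod x : R := c * \prod_(i < N) cos (k * x 0 i) `^ N%:R^-1.

Definition cosbox : set 'rV[R]_N := box (cospos k).

Let gs := cosroot (N%:R^-1) k.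

Let cosprodE : cosprod = sepf c gs (fun=> 0%N).
Proof.
apply/funext => x; rewrite /cosprod /sepf; congr (_ * _).
by apply: eq_bigr => i _; rewrite /gs /cosroot mul1r.
Qed.

Lemma C2_near_cosprod x : cosbox x -> C2_near cosprod x.
Proof.
rewrite cosprodE; apply: C2_near_sepf; first exact: open_cospos.
- exact: is_derive_cosroot.
- exact: cosroot2_continuous.
Qed.

(** Here [q - p^2 = - (k^2 / N) (1 + tan^2)]: the term 1 gives [dot w w], and the rank-one part the
    squared sum. *)
Lemma hessian_cosprod x w : (0 < N)%N -> cosbox x ->
  dot (w *m hessian cosprod x) w =
  cosprod x * (N%:R^-1 * k ^+ 2) *
  (N%:R^-1 * (\sum_i w 0 i * tan (k * x 0 i)) ^+ 2 -
   \sum_i (w 0 i * tan (k * x 0 i)) ^+ 2 - dot w w).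
Proof.
move=> N0 xD; rewrite cosprodE.
rewrite (@hessian_sepf _ _ _ _ (cospos k) (@open_cospos _ k) _ _
  (fun s => - (N%:R^-1 * k) * tan (k * s))
  (fun s => (N%:R^-1 * k) ^+ 2 * tan (k * s) ^+ 2 -
            N%:R^-1 * k ^+ 2 * (1 + tan (k * s) ^+ 2)))//.
- rewrite -mulrA; congr (_ * _).
  have -> : \sum_i w 0 i * (- (N%:R^-1 * k) * tan (k * x 0 i)) =
      - (N%:R^-1 * k) * \sum_i w 0 i * tan (k * x 0 i).
    by rewrite mulr_sumr; apply: eq_bigr => i _; ring.
  rewrite dotE -addrA -opprD -big_split/= mulrBr; congr (_ + _); first by ring.
  rewrite mulr_sumr -sumrN; apply: eq_bigr => i _; ring.
- exact: is_derive_cosroot.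
- by move=> s _; rewrite /gs /cosroot mul1r.
- by move=> s _; rewrite /gs /cosroot mul1r.
Qed.

(** Cauchy-Schwarz against the constant vector, obtained from the nonnegativity of the squared
    deviations from the mean [m]. *)
Lemma sqr_sum_le (f : 'I_N -> R) : (0 < N)%N ->
  N%:R^-1 * (\sum_i f i) ^+ 2 <= \sum_i f i ^+ 2.
Proof.
move=> N0; have NR : (N%:R : R) != 0 by rewrite pnatr_eq0 -lt0n.
pose m := N%:R^-1 * \sum_i f i.
have : 0 <= \sum_i (f i - m) ^+ 2 by apply: sumr_ge0 => i _; exact: sqr_ge0.
have -> : \sum_i (f i - m) ^+ 2 =
    \sum_i f i ^+ 2 - 2 * m * \sum_i f i + N%:R * m ^+ 2.
  rewrite mulr_sumr -sumrB.
  have -> : N%:R * m ^+ 2 = \sum_(i < N) m ^+ 2.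
    by rewrite sumr_const card_ord mulr_natl.
  by rewrite -big_split/=; apply: eq_bigr => i _; ring.
rewrite /m => h; rewrite -subr_ge0; move: h.
move: (\sum_i f i) (\sum_i _ ^+ 2) (N%:R : R) NR => S T n n0.
suff -> : T - 2 * (n^-1 * S) * S + n * (n^-1 * S) ^+ 2 = T - n^-1 * S ^+ 2 by [].
by field.
Qed.

Lemma hessian_cosprod_le x w : (0 < N)%N -> 0 <= cosprod x -> cosbox x ->
  dot (w *m hessian cosprod x) w <= - (N%:R^-1 * k ^+ 2) * cosprod x * dot w w.
Proof.
move=> N0 u0 xD; rewrite hessian_cosprod//.
have := sqr_sum_le (fun i => w 0 i * tan (k * x 0 i)) N0.
have : 0 <= cosprod x * (N%:R^-1 * k ^+ 2).
  apply: mulr_ge0 => //; apply: mulr_ge0; last exact: sqr_ge0.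
  by rewrite invr_ge0 ler0n.
have -> : - (N%:R^-1 * k ^+ 2) * cosprod x * dot w w =
  - (cosprod x * (N%:R^-1 * k ^+ 2) * dot w w) by ring.
by move: (cosprod x * _) => A A0 h; rewrite mulrBr gerDr mulr_ge0_le0// subr_le0.
Qed.

(* The maximum is attained along a coordinate axis where the tangent vanishes,
   or else along the vector whose products with all the tangents are equal. *)
Lemma hessian_cosprod_eq x : (0 < N)%N -> cosbox x ->
  exists2 w, w != 0 & dot (w *m hessian cosprod x) w =
    - (N%:R^-1 * k ^+ 2) * cosprod x * dot w w.
Proof.
move=> N0 xD.
suff [w w0 wE] : exists2 w : 'rV[R]_N, w != 0 &
    N%:R^-1 * (\sum_i w 0 i * tan (k * x 0 i)) ^+ 2 =
    \sum_i (w 0 i * tan (k * x 0 i)) ^+ 2.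
  by exists w => //; rewrite hessian_cosprod// wE; ring.
have [/existsP[j /eqP tj]|] := boolP [exists j, tan (k * x 0 j) == 0].
  exists (delta_mx 0 j).
    apply/eqP => /rowP/(_ j); rewrite !mxE !eqxx => /eqP.
    by rewrite oner_eq0.
  have z i : (delta_mx 0 j : 'rV[R]_N) 0 i * tan (k * x 0 i) = 0.
    by rewrite mxE eqxx /=; case: eqP => [->|_]; rewrite ?tj ?mulr0 ?mul0r.
  by rewrite !big1 ?expr0n ?mulr0// => i _; rewrite z ?expr0n.
rewrite negb_exists => /forallP t0.
have wt i : (\row_j (tan (k * x 0 j))^-1) 0 i * tan (k * x 0 i) = 1.
  by rewrite mxE mulVf.
exists (\row_j (tan (k * x 0 j))^-1).
  apply/eqP => /rowP/(_ (Ordinal N0)) w0; have := wt (Ordinal N0).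
  by rewrite w0 mxE mul0r => /eqP; rewrite eq_sym oner_eq0.
under eq_bigr do rewrite wt.
under [RHS]eq_bigr do rewrite wt expr1n.
rewrite sumr_const card_ord expr2 mulrA mulVf ?mul1r//.
by rewrite pnatr_eq0 -lt0n.
Qed.

End cosine_products.

(** * Hessians and local extrema *)

Section C2_calculus.
Context {R : realType} {N : nat}.
Implicit Types (f g : 'rV[R]_N -> R) (x w : 'rV[R]_N).

(** Basis directions are added one at a time by [is_deriveD_dir], which asks for continuity only of
    the newly added partial derivative. *)
Lemma is_derive_partials f x w :
  (forall i, \forall y \near x, derivable f y (delta_mx 0 i)) ->
  (forall i, {for x, continuous (partial i f)}) ->
  is_derive x w f (\sum_i w 0 i * partial i f x).
Proof.
move=> df cf.
have dZ i y : derivable f y (delta_mx 0 i) ->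
    is_derive y (w 0 i *: delta_mx 0 i) f (w 0 i * partial i f y).
  by move=> dfy; apply: is_deriveZ_dir; apply: derivableP.
rewrite [X in is_derive _ X](row_sum_delta w).
elim: (index_enum 'I_N) => [|i s IH].
  by rewrite !big_nil; exact: is_derive0.
rewrite !big_cons addrC [X in is_derive _ _ _ X]addrC.
have [dv <-] := IH.
have <- : 'D_(w 0 i *: delta_mx 0 i) f x = w 0 i * partial i f x.
  by have [_] := dZ i x (nbhs_singleton (df i)).
apply: is_deriveD_dir; first exact: dv.
  by apply: filterS (df i) => y /dZ[].
apply: (@near_eq_continuous _ _ (fun y => w 0 i * partial i f y)).
  by apply: filterS (df i) => y /dZ[_ ->].
by apply: continuousM; [exact: cst_continuous|exact: cf].
Qed.

Lemma C2_near_derive2 f x w : C2_near f x ->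
  (\forall y \near x, derivable f y w) /\
  is_derive x w ('D_w f) (dot (w *m hessian f x) w).
Proof.
move=> fx.
have d1 : \forall y \near x, is_derive y w f (\sum_i w 0 i * partial i f y).
  (* The C2 conditions hold on a neighbourhood of every point near [x], as [is_derive_partials]
     requires. *)
  move: fx => /nbhs_interior; apply: filterS => y fy; apply: is_derive_partials.
    by move=> i; apply: filterS fy => z [_ + _] => /(_ i)[].
  by move=> i; have [_ + _] := nbhs_singleton fy => /(_ i)[].
split; first by apply: filterS d1 => y [].
apply: (@near_eq_is_derive _ _ _ (fun y => \sum_i w 0 i * partial i f y)).
  by apply: filterS d1 => y [_].
have d2 j : is_derive x w (partial j f)
    (\sum_i w 0 i * partial i (partial j f) x).
  apply: is_derive_partials => i.
    by apply: filterS fx => z [_ _] => /(_ i j)[].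
  by have [_ _] := nbhs_singleton fx => /(_ i j)[].
rewrite dotE.
have -> : (fun y => \sum_i w 0 i * partial i f y) =
    \sum_i (w 0 i \*: partial i f).
  by apply/funext => y; rewrite fct_sumE.
apply: is_derive_eq; apply: eq_bigr => j _.
rewrite mulrC mxE mulrC [LHS]mulrC; congr (_ * _).
by apply: eq_bigr => i _; rewrite mxE.
Qed.

Lemma hessian_sym f x : C2_near f x -> (hessian f x)^T = hessian f x.
Proof.
move=> fx; apply/matrixP => i j; rewrite !mxE.
apply: derive_dirC.
- by apply: filterS fx => y [_ + _] => /(_ j)[].
- by apply: filterS fx => y [_ + _] => /(_ i)[].
- by apply: filterS fx => y [_ _] => /(_ i j)[].
- by apply: filterS fx => y [_ _] => /(_ j i)[].
- by have [_ _ /(_ j i)[]] := nbhs_singleton fx.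
- by have [_ _ /(_ i j)[]] := nbhs_singleton fx.
Qed.

(** Second-order condition for [f - g] along [w]. It transfers Hessian bounds between a smooth
    function and a test function touching it. *)
Lemma hessian_local_min f g x w : C2_near f x -> C2_near g x ->
  (\forall y \near x, f x - g x <= f y - g y) ->
  dot (w *m hessian g x) w <= dot (w *m hessian f x) w.
Proof.
move=> fx gx fgmin.
have [df d2f] := C2_near_derive2 w fx; have [dg d2g] := C2_near_derive2 w gx.
have dfg : \forall y \near x, 'D_w f y - 'D_w g y = 'D_w (f - g) y.
  by apply: filterS (filterI df dg) => y [dfy dgy]; rewrite deriveB.
have [d2 E] : is_derive x w ('D_w (f - g))
    (dot (w *m hessian f x) w - dot (w *m hessian g x) w).
  exact: (@near_eq_is_derive _ _ _ _ _ x w _ dfg (is_deriveB d2f d2g)).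
rewrite -subr_ge0 -E; apply: derive2_local_min; [|exact: d2|exact: fgmin].
by apply: filterS (filterI df dg) => y [dfy dgy]; exact: derivableB.
Qed.

End C2_calculus.

(** * The cube *)

(* A cluster point of the superlevel sets is a maximum point. *)
Lemma usc_compact_max (R : realType) (T : topologicalType) (K : set T)
    (h : T -> R) : K !=set0 -> compact K ->
  (forall x a, K x -> h x < a -> \forall y \near x, K y -> h y < a) ->
  exists2 x, K x & forall y, K y -> h y <= h x.
Proof.
move=> [x0 Kx0] cK usc.
pose F := filter_from K (fun z => [set y | K y /\ h z <= h y]).
have FF : Filter F.
  apply: filter_from_filter; first by exists x0.
  move=> y z Ky Kz; have [yz|/ltW zy] := leP (h y) (h z).
    by exists z => // t [Kt zt]; split; split=> //; exact: le_trans zt.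
  by exists y => // t [Kt yt]; split; split=> //; exact: le_trans yt.
have PF : ProperFilter F.
  by apply: filter_from_proper => // z Kz; exists z; split.
have FK : F K by exists x0 => // y [].
have [p [Kp Fp]] := cK F PF FK.
exists p => // z Kz; rewrite leNgt; apply/negP => pz.
have Fz : F [set y | K y /\ h z <= h y] by exists z.
have [y [[Ky zy] /(_ Ky)]] := Fp _ _ Fz (usc _ _ Kp pz).
by rewrite ltNge zy.
Qed.

Lemma continuous_powR_pos_part (R : realType) (a : R) : 0 < a ->
  continuous (fun y : R => Num.max 0 y `^ a).
Proof.
move=> a0 y; have [y0|y0|y0] := ltgtP y 0.
- apply: (@near_eq_continuous _ _ (fun=> 0)); last exact: cst_continuous.
  near=> z; have z0 : z < 0 by near: z; exact: lt_nbhsl.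
  by rewrite max_l ?(ltW z0)// powR0 ?gt_eqF.
- apply: (@near_eq_continuous _ _ (fun z => z `^ a)).
    near=> z; have z0 : 0 < z by near: z; exact: lt_nbhsr.
    by rewrite max_r// ltW.
  apply/differentiable_continuous/derivable1_diffP.
  by have [] := is_derive1_powR a y0.
rewrite y0 => {y y0}.
rewrite /prop_for /continuous_at maxxx powR0 ?gt_eqF//.
apply/cvgrPdist_lt => e e0.
(* At the origin the radius is the inverse power of [e], by monotonicity of the power. *)
have e'0 : 0 < e `^ a^-1 by exact: powR_gt0.
near=> z; rewrite sub0r normrN ger0_norm ?powR_ge0//.
have -> : e = (e `^ a^-1) `^ a.
  by rewrite -powRrM mulVf ?gt_eqF// powRr1 ?ltW.
apply: gt0_ltr_powR => //; rewrite ?nnegrE ?powR_ge0 ?le_max ?lexx//.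
rewrite gt_max e'0 /=; near: z; exact: lt_nbhsl.
Unshelve. all: by end_near. Qed.

Section cube_lemmas.
Context {R : realType} {N : nat}.
Implicit Types (D : set R) (x : 'rV[R]_N) (r : R).

Lemma open_box D : open D -> open (box D : set 'rV[R]_N).
Proof. by move=> oD; rewrite openE => x /(box_nbhs oD). Qed.

Lemma closed_box D : closed D -> closed (box D : set 'rV[R]_N).
Proof.
move=> cD; have -> : box D =
    \bigcap_(i in [set: 'I_N]) ((fun x : 'rV[R]_N => x 0 i) @^-1` D).
  by apply/seteqP; split=> [x xD i _|x xD i]; [exact: xD | exact: xD i I].
apply: closed_bigI => i _; apply: preimage_closed => // x _.
exact: coord_continuous.
Qed.

Lemma compact_box D : compact D -> compact (box D : set 'rV[R]_N).
Proof. by move=> cD; exact: (@rV_compact _ _ (fun=> D)). Qed.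

Lemma open_cube r : open (cube N r : set 'rV[R]_N).
Proof.
have -> : cube N r = box [set` `]- r, r[] :> set 'rV[R]_N.
  by apply/seteqP; split=> x xr i; have := xr i; rewrite /= in_itv.
exact/open_box/itv_open.
Qed.

Definition closed_cube r : set 'rV[R]_N := [set x | forall i, - r <= x 0 i <= r].

Let closed_cubeE r : closed_cube r = box [set` `[- r, r]].
Proof. by apply/seteqP; split=> x xr i; have := xr i; rewrite /= in_itv. Qed.

Lemma compact_closed_cube r : compact (closed_cube r).
Proof. by rewrite closed_cubeE; apply: compact_box; exact: segment_compact. Qed.

Lemma closure_cube r : closure (cube N r) `<=` closed_cube r.
Proof.
have cc : closed (closed_cube r).
  by rewrite closed_cubeE; apply: closed_box; exact: interval_closed.
rewrite [X in _ `<=` X]((closure_id _).1 cc); apply: closure_subset => x xr i.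
by have /andP[a b] := xr i; rewrite !ltW.
Qed.

Let pihr r s : 0 < r -> pi / (2 * r) * (s * r) = s * (pi / 2).
Proof. by move=> r0; field; rewrite gt_eqF. Qed.

Lemma cube_cosbox r x : 0 < r -> cube N r x -> cosbox (pi / (2 * r)) x.
Proof.
move=> r0 xr i; apply: cos_gt0_pihalf.
have k0 : 0 < pi / (2 * r) by rewrite divr_gt0 ?pi_gt0 ?mulr_gt0.
have /andP[a b] := xr i.
apply/andP; split; last by rewrite -[ltRHS]mul1r -(pihr 1 r0) mul1r ltr_pM2l.
by rewrite -mulN1r -(pihr (-1) r0) mulN1r ltr_pM2l.
Qed.

Lemma closed_cube_cos_ge0 r x i : 0 < r -> closed_cube r x ->
  0 <= cos (pi / (2 * r) * x 0 i).
Proof.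
move=> r0 xr; apply: cos_ge0_pihalf.
have k0 : 0 < pi / (2 * r) by rewrite divr_gt0 ?pi_gt0 ?mulr_gt0.
have /andP[a b] := xr i.
apply/andP; split; last by rewrite -[leRHS]mul1r -(pihr 1 r0) mul1r ler_pM2l.
by rewrite -mulN1r -(pihr (-1) r0) mulN1r ler_pM2l.
Qed.

Lemma cosprod_gt0 (c k : R) x : 0 < c -> cosbox k x -> 0 < cosprod c k x.
Proof.
move=> c0 xD; rewrite mulr_gt0// prodr_gt0// => i _.
by apply: powR_gt0; exact: xD.
Qed.

(** Some coordinate is [r] or [- r], where the cosine is that of a right angle. The power of 0 is 0
    because the exponent [1 / N] is nonzero. *)
Lemma cosprod_eq0 (c : R) r x : (0 < N)%N -> 0 < r -> closed_cube r x ->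
  ~ cube N r x -> cosprod c (pi / (2 * r)) x = 0.
Proof.
move=> N0 r0 xr /existsNP[i xi].
suff c0 : cos (pi / (2 * r) * x 0 i) = 0.
  rewrite /cosprod (bigD1 i)//= c0 powR0 ?mul0r ?mulr0//.
  by rewrite invr_eq0 pnatr_eq0 -lt0n.
have /andP[] := xr i; rewrite le_eqVlt => /predU1P[<- _|a].
  by rewrite -mulN1r pihr// mulN1r cosN cos_pihalf.
rewrite le_eqVlt => /predU1P[->|b]; last by case: xi; rewrite a.
by rewrite -[X in _ * X]mul1r pihr// mul1r cos_pihalf.
Qed.

(* Truncation is needed for continuity: y `^ a is 1 at negative y. *)
Definition cosprod_pos (k : R) x : R :=
  \prod_(i < N) Num.max 0 (cos (k * x 0 i)) `^ N%:R^-1.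

Lemma cosprod_pos_continuous k : (0 < N)%N -> continuous (cosprod_pos k).
Proof.
move=> N0; apply: (continuous_big mul_continuous) => i _ x.
apply: (@continuous_comp _ _ _ (fun x => cos (k * x 0 i))
  (fun y => Num.max 0 y `^ N%:R^-1)); last first.
  by apply: continuous_powR_pos_part; rewrite invr_gt0 ltr0n.
apply: (@continuous_comp _ _ _ (fun x : 'rV[R]_N => k * x 0 i) cos); last first.
  exact: continuous_cos.
by apply: continuousM; [exact: cst_continuous | exact: coord_continuous].
Qed.

Lemma cosprod_posE r x : 0 < r -> closed_cube r x ->
  cosprod_pos (pi / (2 * r)) x = cosprod 1 (pi / (2 * r)) x.
Proof.
move=> r0 xr; rewrite /cosprod mul1r; apply: eq_bigr => i _.
by rewrite max_r// closed_cube_cos_ge0.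
Qed.

End cube_lemmas.

(** * The principal eigenvalue *)

Section principal_eigenvalue_cube.
Context {R : realType} {N : nat}.
Context (N0 : (0 < N)%N).
Implicit Types (x : 'rV[R]_N) (r : R).

Let eigval (r : R) : R := N%:R^-1 * (pi / (2 * r)) ^+ 2.
Let u (r : R) : 'rV[R]_N -> R := cosprod 1 (pi / (2 * r)).

(** A test function touching from below has a smaller Hessian form than [u r], in every
    direction. *)
Lemma cosprod_viscosity_le0 r : 0 < r -> viscosity_le0 (cube N r) (eigval r) (u r).
Proof.
move=> r0 x psi xr Cpsi touch; have xD := cube_cosbox r0 xr.
rewrite -lerBrDr sub0r -mulNr; apply: P1plus_le => // [|w].
  exact: hessian_sym.
apply: le_trans (hessian_cosprod_le w N0 _ xD); last first.
  by rewrite ltW// cosprod_gt0.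
exact: hessian_local_min (C2_near_cosprod _ xD) Cpsi touch.
Qed.

(** A test function touching from above has a larger Hessian form; one extremal direction of the
    Hessian of [u r] suffices to bound the largest eigenvalue below. *)
Lemma cosprod_viscosity_ge0 r : 0 < r -> viscosity_ge0 (cube N r) (eigval r) (u r).
Proof.
move=> r0 x psi xr Cpsi touch; have xD := cube_cosbox r0 xr.
have [w w0 wE] := hessian_cosprod_eq 1 N0 xD.
rewrite -lerBlDr sub0r -mulNr; apply: (P1plus_ge N0 _ w0).
  exact: hessian_sym.
rewrite -wE; apply: hessian_local_min Cpsi (C2_near_cosprod _ xD) _.
by apply: filterS touch => y; rewrite -lerN2 !opprB.
Qed.

Lemma cosprod_continuous_closure r : 0 < r ->
  {within closure (cube N r), continuous (u r)}.
Proof.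
move=> r0; apply: (@subspace_eq_continuous _ _ _ (cosprod_pos (pi / (2 * r)))).
  by move=> x; rewrite inE => /closure_cube xr; exact: cosprod_posE.
by apply: continuous_subspaceT; exact: cosprod_pos_continuous.
Qed.

Lemma cosprod_lsc r : 0 < r ->
  lower_semicontinuous (fun x : subspace (cube N r) => (u r x)%:E).
Proof.
move=> r0 x a; rewrite lte_fin => ax.
have cu : {within cube N r, continuous (u r)}.
  by apply: continuous_subspaceW (cosprod_continuous_closure r0); exact: subset_closure.
exists [set y | a < u r y]; last by move=> y; rewrite /= lte_fin.
exact: (cvgr_gt _ (cu x)).
Qed.

Lemma principal_eigenvalue_le r mu phi : 0 < r ->
  lower_semicontinuous (fun x : subspace (cube N r) => (phi x)%:E) ->
  (forall x, cube N r x -> 0 < phi x) ->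
  viscosity_le0 (cube N r) mu phi -> forall s, 0 < s < r -> mu <= eigval s.
Proof.
move=> r0 lsc phi0 visc s /andP[s0 sr].
have sub : closed_cube s `<=` cube N r.
  move=> x xs i; have /andP[a b] := xs i.
  by rewrite (lt_le_trans _ a) ?ltrN2// (le_lt_trans b).
have vE x := @cosprod_posE R N s x s0.
pose v := @cosprod_pos R N (pi / (2 * s)).
have v_ge0 x : 0 <= v x by apply: prodr_ge0 => i _; exact: powR_ge0.
have cv : continuous v by exact: cosprod_pos_continuous.
(* Relative neighbourhoods in the cube are turned into ambient ones. *)
have lsc_phi x b : cube N r x -> b < phi x ->
    \forall y \near x, cube N r y -> b < phi y.
  move=> xr bx; have [V Vx VP] := lsc x b bx.
  have xV : \forall y \near x, cube N r y -> V y.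
    by move: Vx; rewrite {1}/nbhs/= -nbhs_subspace_in.
  by apply: filterS xV => y yV yr; have := VP y (yV yr); rewrite lte_fin.
have closed0 : closed_cube s (0 : 'rV[R]_N).
  by move=> i; rewrite mxE oppr_le0 !ltW.
(* The quotient [v / phi] is maximised instead of minimising [phi / v], since [v] vanishes on the
   boundary of the small cube while [phi] is positive there. *)
have [|x xs xmax] := @usc_compact_max R _ (closed_cube s) (fun x => v x / phi x)
    (ex_intro _ _ closed0) (@compact_closed_cube _ _ s).
  move=> x a xs; have px := phi0 x (sub x xs).
  rewrite ltr_pdivrMr// => va.
  have a0 : 0 < a by rewrite -(pmulr_lgt0 _ px) (le_lt_trans _ va).
  (* With [b] halfway between [v x / a] and [phi x], the bounds [v < a * b] and [b < phi] persist
     near [x] and give [v / phi < a]. *)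
  have [b vb bphi] : exists2 b, v x < a * b & b < phi x.
    exists ((v x / a + phi x) / 2).
      have : v x / a < phi x by rewrite ltr_pdivrMr// mulrC.
      by rewrite -ltr_pdivrMl// [a^-1 * _]mulrC => h; lra.
    have : v x / a < phi x by rewrite ltr_pdivrMr// mulrC.
    by move=> h; lra.
  have vnear : \forall y \near x, v y < a * b by exact: (cvgr_lt _ (cv x)).
  apply: filterS (filterI vnear (lsc_phi x b (sub x xs) bphi)) => y [vy phiy] ys.
  rewrite ltr_pdivrMr ?phi0//; last exact: sub.
  by apply: lt_trans vy _; rewrite ltr_pM2l// phiy//; exact: sub.
have px := phi0 x (sub x xs).
(* The maximum is at least the value at the centre, where [v] is positive; this excludes boundary
   points. *)
have vx0 : 0 < v x.
  rewrite -(pmulr_lgt0 _ (_ : 0 < (phi x)^-1)) ?invr_gt0//.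
  apply: lt_le_trans (xmax 0 closed0).
  rewrite divr_gt0 ?phi0//; last exact: sub.
  rewrite /v vE// cosprod_gt0//; apply: cube_cosbox => // i.
  by rewrite mxE oppr_lt0 s0.
have xo : cube N s x.
  apply: contrapT => xo; move: vx0.
  by rewrite /v vE// cosprod_eq0// ltxx.
have xD := cube_cosbox s0 xo.
pose t := phi x / v x; pose psi := @cosprod R N t (pi / (2 * s)).
have t0 : 0 < t by rewrite divr_gt0.
have psiE y : closed_cube s y -> psi y = t * v y.
  by move=> ys; rewrite /v vE// /psi /cosprod mul1r.
have psix : psi x = phi x by rewrite psiE// /t divfK// gt_eqF.
have Cpsi : C2_near psi x by exact: C2_near_cosprod.
have touch : \forall y \near x, phi x - psi x <= phi y - psi y.
  have : nbhs x (cube N s) by apply: open_nbhs_nbhs; split=> //; exact: open_cube.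
  apply: filterS => y yo; have ys : closed_cube s y.
    exact/closure_cube/subset_closure.
  rewrite psix subrr subr_ge0 psiE// /t mulrAC ler_pdivrMr//.
  have := xmax y ys; rewrite ler_pdivrMr ?phi0//; last exact: sub.
  by rewrite mulrAC ler_pdivlMr// [v y * _]mulrC [v x * _]mulrC.
have := visc x psi (sub x xs) Cpsi touch.
(* In an extremal direction of [psi], [P1plus] is at least [- eigval s * phi x]; combined with the
   inequality for [phi], this leaves [(mu - eigval s) * phi x <= 0]. *)
have [w w0 wE] := hessian_cosprod_eq t N0 xD.
have := P1plus_ge N0 (hessian_sym Cpsi) w0 _; rewrite wE => /(_ _ (lexx _)).
rewrite -/psi psix => h1 h2.
have : (mu - eigval s) * phi x <= 0.
  rewrite mulrBl; apply: le_trans h2; rewrite addrC lerD2r.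
  by rewrite -mulNr.
by rewrite pmulr_lle0// subr_le0.
Qed.

Lemma principal_eigenvalue_cube r : 0 < r ->
  principal_eigenvalue (cube N r) = (eigval r)%:E.
Proof.
move=> r0; apply/eqP; rewrite eq_le; apply/andP; split.
  apply: ge_ereal_sup => _ [mu [phi [lsc phi0 visc]] <-]; rewrite lee_fin.
  have eigvalE s : 0 < s -> eigval s = N%:R^-1 * (pi / 2) ^+ 2 / s ^+ 2.
    move=> s0; rewrite /eigval; field.
    by rewrite pnatr_eq0 -lt0n N0 gt_eqF.
  rewrite leNgt; apply/negP => emu.
  have m0 : 0 < N%:R^-1 * (pi / 2 : R) ^+ 2.
    by rewrite mulr_gt0 ?invr_gt0 ?ltr0n// exprn_gt0// divr_gt0// pi_gt0.
  have mu0 : 0 < mu.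
    by apply: lt_trans emu; rewrite eigvalE// divr_gt0// exprn_gt0.
  move: emu; rewrite eigvalE// ltr_pdivrMr ?exprn_gt0// => emu.
  (* Since [eigval s = m / s^2], any [s^2] strictly between [m / mu] and [r^2] gives [s < r] and
     [eigval s < mu]; [d] is the midpoint. *)
  pose m := N%:R^-1 * (pi / 2 : R) ^+ 2; pose d := (m / mu + r ^+ 2) / 2.
  have md : m / mu < d.
    have : m / mu < r ^+ 2 by rewrite ltr_pdivrMr// mulrC.
    by rewrite /d => h; lra.
  have dr : d < r ^+ 2.
    have : m / mu < r ^+ 2 by rewrite ltr_pdivrMr// mulrC.
    by rewrite /d => h; lra.
  have d0 : 0 < d by apply: lt_trans md; rewrite divr_gt0.
  have s0 : 0 < Num.sqrt d by rewrite sqrtr_gt0.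
  have sr : Num.sqrt d < r.
    by rewrite -(ltr_pXn2r (n := 2)) ?nnegrE ?ltW// sqr_sqrtr// ltW.
  have := principal_eigenvalue_le r0 lsc phi0 visc (s := Num.sqrt d).
  rewrite s0 sr => /(_ isT); rewrite leNgt => /negP; apply.
  rewrite eigvalE// sqr_sqrtr ?ltW// -/m ltr_pdivrMr// mulrC.
  by rewrite -ltr_pdivrMr.
apply: ereal_sup_ubound; exists (eigval r) => //; exists (u r); split.
- exact: cosprod_lsc.
- by move=> x xr; rewrite cosprod_gt0//; exact: cube_cosbox.
- exact: cosprod_viscosity_le0.
Qed.

End principal_eigenvalue_cube.

Theorem theorem2 (R : realType) (N : nat) (r : R)
    (hN : (2 <= N)%N) (hr : 0 < r) :
  principal_eigenvalue (cube N r) = (N%:R^-1 * (pi / (2 * r)) ^+ 2)%:E /\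
  principal_eigenfunction (cube N r)
    (fun x => \prod_(i < N) cos (pi / (2 * r) * x 0 i) `^ N%:R^-1).
Proof.
have N0 : (0 < N)%N by exact: ltnW.
have eigval := principal_eigenvalue_cube N0 hr.
split=> //.
have uE (x : 'rV[R]_N) :
    \prod_(i < N) cos (pi / (2 * r) * x 0 i) `^ N%:R^-1 =
    cosprod 1 (pi / (2 * r)) x by rewrite /cosprod mul1r.
rewrite (funext uE).
exists (N%:R^-1 * (pi / (2 * r)) ^+ 2) => //; split.
- exact: cosprod_continuous_closure.
- by move=> x xr; apply: cosprod_gt0 => //; exact: cube_cosbox.
- move=> x [/closure_cube xr].
  rewrite (_ : _° = cube N r); last by apply/interior_id/open_cube.
  exact: cosprod_eq0.
- exact: cosprod_viscosity_le0.
- exact: cosprod_viscosity_ge0.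
Qed.
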